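(* Let $X$ and $Y$ be Polish spaces and let $\mathcal{F}\subseteq Y^X$ be a family of functions from $X$ to $Y$. The game $G''_{\mathcal{F}}$ is determined (i.e. one of the two players has a winning strategy), and \begin{itemize} \item Player I has a winning strategy in $G''_{\mathcal{F}}$ if and only if $\mathcal{F}$ is not equi-Baire 1; \item Player II has a winning strategy in $G''_{\mathcal{F}}$ if and only if $\mathcal{F}$ is equi-Baire 1. \end{itemize}
   Context: $X$ and $Y$ are Polish spaces with fixed compatible complete metrics $d_X$ and $d_Y$. A family $\mathcal{F}\subseteq Y^X$ is equi-Baire 1 if for every $\varepsilon>0$ there is a function $\delta_\varepsilon\colon X\to(0,\infty)$ such that for all $x_0,x_1\in X$ and all $f\in\mathcal{F}$: $d_X(x_0,x_1)<\min\{\delta_\varepsilon(x_0),\delta_\varepsilon(x_1)\}$ implies $d_Y(f(x_0),f(x_1))<\varepsilon$. The game $G''_{\mathcal{F}}$: the players alternately play $x_0,U_0,x_1,U_1,x_2,U_2,\dots$, where Player I plays the points $x_n$ and Player II plays the sets $U_n$, with the rules: $x_0\in X$, and $x_n\in U_{n-1}$ for $n>0$; each $U_n$ is an open subset of $X$ with $x_n\in U_n$. Player II wins if $\langle x_n\rangle$ converges to some $x\in X$ and the indexed family $\{\langle f(x_n)\rangle\colon f\in\mathcal{F}\}$ is equi-convergent to $\{f(x)\colon f\in\mathcal{F}\}$, meaning $$\forall_{\varepsilon>0}\ \exists_{N\in\mathbb{N}}\ \forall_{n\ge N}\ \forall_{f\in\mathcal{F}}\quad d_Y(f(x_n),f(x))<\varepsilon;$$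 otherwise Player I wins. The rules are binding: the first player who does not make a legal move loses. The Axiom of Choice is assumed. *)

(* Defs.v *)
From HB Require Import structures.
From mathcomp Require Import all_boot all_order all_algebra.
From mathcomp Require Import all_classical all_reals all_analysis.

Set Implicit Arguments.
Unset Strict Implicit.
Unset Printing Implicit Defensive.

Import Order.TTheory GRing.Theory Num.Theory.
Import numFieldNormedType.Exports.

Local Open Scope classical_set_scope.
Local Open Scope ring_scope.

(* Library completeness ([completeType], [cauchy_cvg]) is only available for
   pointed spaces; the axiom is restated here so that the empty space is
   allowed. *)
Definition complete_space (T : uniformType) : Prop :=
  forall F : set_system T, ProperFilter F -> cauchy F -> exists x : T, F --> x.

Definition separable_space (T : topologicalType) : Prop :=
  exists2 D : set T, countable D & dense D.

(* A [metricType] carries both the topology and a compatible metric [mdist];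
   being Polish here means that this fixed metric is complete. *)
Definition polish (R : realType) (T : metricType R) : Prop :=
  complete_space T /\ separable_space T.

Definition equi_Baire1 (R : realType) (X Y : metricType R)
    (F : set (X -> Y)) : Prop :=
  forall eps : R, 0 < eps ->
    exists delta : X -> R, (forall x, 0 < delta x) /\
      forall (x0 x1 : X) (f : X -> Y), F f ->
        mdist x0 x1 < Num.min (delta x0) (delta x1) ->
        mdist (f x0) (f x1) < eps.

Definition equi_convergent (R : realType) (X Y : metricType R)
    (F : set (X -> Y)) (x : nat -> X) (l : X) : Prop :=
  forall eps : R, 0 < eps ->
    exists N : nat, forall n : nat, (N <= n)%N ->
      forall f : X -> Y, F f -> mdist (f (x n)) (f l) < eps.

(* A play x 0, U 0, x 1, U 1, ... is given by two infinite sequences. Whatever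
   is recorded after the first illegal move has no effect on the outcome. *)
Definition legal_I (X : topologicalType) (x : nat -> X) (U : nat -> set X)
    (n : nat) : Prop :=
  if n is m.+1 then U m (x n) else True.

Definition legal_II (X : topologicalType) (x : nat -> X) (U : nat -> set X)
    (n : nat) : Prop :=
  open (U n) /\ U n (x n).

Definition legal_before (X : topologicalType) (x : nat -> X) (U : nat -> set X)
    (n : nat) : Prop :=
  forall m : nat, (m < n)%N -> legal_I x U m /\ legal_II x U m.

Definition legal_play (X : topologicalType) (x : nat -> X) (U : nat -> set X) :
    Prop :=
  forall n : nat, legal_I x U n /\ legal_II x U n.

Definition limit_condition (R : realType) (X Y : metricType R)
    (F : set (X -> Y)) (x : nat -> X) : Prop :=
  exists l : X, x @ \oo --> l /\ equi_convergent F x l.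

Definition II_wins (R : realType) (X Y : metricType R) (F : set (X -> Y))
    (x : nat -> X) (U : nat -> set X) : Prop :=
  (exists n : nat, legal_before x U n /\ ~ legal_I x U n) \/
  (legal_play x U /\ limit_condition F x).

Definition I_wins (R : realType) (X Y : metricType R) (F : set (X -> Y))
    (x : nat -> X) (U : nat -> set X) : Prop :=
  (exists n : nat, [/\ legal_before x U n, legal_I x U n & ~ legal_II x U n]) \/
  (legal_play x U /\ ~ limit_condition F x).

Definition history (X : Type) (x : nat -> X) (U : nat -> set X) (n : nat) :
    seq (X * set X) :=
  mkseq (fun i => (x i, U i)) n.

(* For empty X there is no strategy for Player I, who has no legal first move,
   and every strategy for Player II is vacuously winning. *)
Definition strategy_I (X : Type) : Type := seq (X * set X) -> X.

Definition strategy_II (X : Type) : Type := seq (X * set X) -> X -> set X.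

Definition follows_I (X : Type) (s : strategy_I X)
    (x : nat -> X) (U : nat -> set X) : Prop :=
  forall n : nat, x n = s (history x U n).

Definition follows_II (X : Type) (t : strategy_II X)
    (x : nat -> X) (U : nat -> set X) : Prop :=
  forall n : nat, U n = t (history x U n) (x n).

Definition I_has_winning_strategy (R : realType) (X Y : metricType R)
    (F : set (X -> Y)) : Prop :=
  exists s : strategy_I X,
    forall (x : nat -> X) (U : nat -> set X), follows_I s x U -> I_wins F x U.

Definition II_has_winning_strategy (R : realType) (X Y : metricType R)
    (F : set (X -> Y)) : Prop :=
  exists t : strategy_II X,
    forall (x : nat -> X) (U : nat -> set X), follows_II t x U -> II_wins F x U.

Definition determined (R : realType) (X Y : metricType R)
    (F : set (X -> Y)) : Prop :=
  I_has_winning_strategy F \/ II_has_winning_strategy F.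

Lemma I_winsE (R : realType) (X Y : metricType R) (F : set (X -> Y))
    (x : nat -> X) (U : nat -> set X) : I_wins F x U <-> ~ II_wins F x U.
Proof.
split.
- move=> Iw [[m [bm nm]]|[lp lim]]; case: Iw.
  + move=> [n [bn ln nn]]; case: (ltngtP m n) => mn.
    * by case: (bn _ mn) => /nm.
    * by case: (bm _ mn) => _ /nn.
    * by apply: nm; rewrite mn.
  + by move=> [lp _]; case: (lp m) => /nm.
  + by move=> [n [_ _ nn]]; case: (lp n) => _ /nn.
  + by move=> [_ /(_ lim)].
- move=> nII; have [lp|nlp] := pselect (legal_play x U).
    by right; split=> // lim; apply: nII; right.
  left; have [n nn] : exists n, ~ (legal_I x U n /\ legal_II x U n).
    exact/existsNP.
  have ex : exists n, `[< ~ (legal_I x U n /\ legal_II x U n) >].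
    by exists n; apply/asboolP.
  case: (ex_minnP ex) => m /asboolP nm minm; exists m.
  have bm : legal_before x U m.
    move=> k km; apply: contrapT => nk.
    by have := minm k (introT (asboolP _) nk); rewrite leqNgt km.
  have lm : legal_I x U m.
    by apply: contrapT => nlm; apply: nII; left; exists m.
  by split=> // lm'; apply: nm.
Qed.

(* Main.v *)
Require Import Defs.
From mathcomp Require Import all_boot all_order all_algebra.
From mathcomp Require Import all_classical all_reals all_analysis.
From mathcomp Require Import lra.

(** Whether [F] is equi-Baire 1 is decided by its oscillation on closed sets.
    Say that [F] has oscillation below [eps] on small portions if every nonempty
    closed set [C] has a nonempty relatively open piece on which all [f] in [F]
    vary, simultaneously, by less than [eps].

    If this holds for every [eps], exhaust [X] transfinitely by peeling off such
    a piece from what is left.  A point [x] peeled off with the open set [U] gets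
    a radius [delta x] with [ball x (delta x)] inside [U]; two points closer than
    both of their radii were then peeled off at the same stage, so [F] varies
    little between them, and [F] is equi-Baire 1
    ([small_portions_equi_gauge]; Zorn's lemma does the peeling).

    Hence if [F] is not equi-Baire 1, there are [eps] and a nonempty closed [C]
    such that [F] varies by at least [eps] on each portion of [C].  Player I
    stays in [C] and always moves to a point at which some [f] in [F] has moved
    by at least [eps / 2] from its previous value.  Values along the play are then
    not uniformly Cauchy, let alone equi-convergent ([not_equi_Baire1_I_wins]).

    If [F] is equi-Baire 1, Player II answers [x n] with a ball around it, cut
    down to the previous move, of radius less than [1 / (n + 1)] and than the
    gauges at [x n] for the first [n + 1] of a sequence of tolerances tending to
    0.  The play converges by completeness of [X]; its limit [l] is within the
    gauge of [x n] by the choice of the radius, and [x n] is eventually within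
    the gauge of [l] because [x n] tends to [l], so the definition of equi-Baire 1
    applies to the pair [x n], [l] ([equi_Baire1_II_wins]).

    The two players cannot both have winning strategies, since these can be
    played against each other ([not_both_win]); the three claims follow. *)

Set Implicit Arguments.
Unset Strict Implicit.
Unset Printing Implicit Defensive.

Import Order.TTheory GRing.Theory Num.Theory.
Import metricType_numDomainType.

Local Open Scope classical_set_scope.
Local Open Scope ring_scope.

(** * Metric preliminaries *)

Lemma open_mdistP (R : realType) (X : metricType R) (A : set X) :
  open A <-> forall x, A x -> exists2 r : R, 0 < r &
    forall y, mdist x y < r -> A y.
Proof.
rewrite openE; split=> oA x Ax.
  by have /nbhs_mdistP[r r0 rA] := oA x Ax; exists r.
by have [r r0 rA] := oA x Ax; apply/nbhs_mdistP; exists r.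
Qed.

Lemma open_mdist_ball (R : realType) (X : metricType R) (x : X) (r : R) :
  open [set y | mdist x y < r].
Proof.
apply/open_mdistP => y /= xy; exists (r - mdist x y); first by rewrite subr_gt0.
by move=> z yz; have := metric_triangle x y z; lra.
Qed.

(** A sequence trapped in balls of shrinking radii around its own terms is
    Cauchy, and its limit lies in all the closed balls. *)
Lemma nested_balls_cvg (R : realType) (X : metricType R) (x : nat -> X)
    (r : nat -> R) (cX : complete_space X)
    (r_small : forall e, 0 < e -> exists n, r n < e)
    (x_in : forall m n, (m <= n)%N -> mdist (x m) (x n) < r m) :
  exists2 l, x @ \oo --> l & forall m, mdist (x m) l <= r m.
Proof.
have [|l xl] := cX (x @ \oo).
  apply/(@cauchyP R X) => e /r_small[N rN]; exists (x N).
  exists N => // n /= Nn; rewrite ballEmdist /=.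
  exact: lt_trans (x_in _ _ Nn) rN.
exists l => // m; apply/ler_addgt0Pr => e e0.
have /cvgrPdist_lt/(_ e e0)[N _ NP] := xl.
have := NP (maxn m N) (leq_maxr _ _).
have := x_in m (maxn m N) (leq_maxl _ _).
rewrite (metric_sym l) => xm xN.
by have := metric_triangle (x m) (x (maxn m N)) l; lra.
Qed.

(** * Gauges from small oscillation on portions of closed sets *)

Definition small_portions (R : realType) (X Y : metricType R)
    (F : set (X -> Y)) (eps : R) : Prop :=
  forall C : set X, closed C -> C !=set0 ->
    exists U : set X, [/\ open U, (C `&` U) !=set0 &
      forall (f : X -> Y) (x y : X), F f -> (C `&` U) x -> (C `&` U) y ->
        mdist (f x) (f y) < eps].

(** A stage of the transfinite peeling, given by the radii of the points peeled
    off so far.  Encoding it as a set of pairs, not necessarily a function, makes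
    the union of a chain again a stage.  The first clause keeps what is peeled
    off open, and also keeps each ball from reaching points of later stages. *)
Definition partial_gauge (R : realType) (X Y : metricType R)
    (F : set (X -> Y)) (eps : R) (G : set (X * R)) : Prop :=
  (forall x r, G (x, r) ->
     0 < r /\ forall y, mdist x y < r -> exists s, G (y, s)) /\
  (forall x0 r0 x1 r1 (f : X -> Y), G (x0, r0) -> G (x1, r1) -> F f ->
     mdist x0 x1 < Num.min r0 r1 -> mdist (f x0) (f x1) < eps).

Lemma partial_gauge_chain (R : realType) (X Y : metricType R)
    (F : set (X -> Y)) (eps : R) (K : set (set (X * R))) :
  K `<=` partial_gauge F eps -> total_on K subset ->
  partial_gauge F eps (\bigcup_(G in K) G).
Proof.
move=> Kg Ktot; split.
  move=> x r [G KG Gxr]; have [r0 rG] := (Kg G KG).1 x r Gxr; split=> // y xy.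
  by have [s Gs] := rG y xy; exists s; exists G.
move=> x0 r0 x1 r1 f [G KG G0] [H KH H1].
have [GH|HG] := Ktot G H KG KH.
  exact: (Kg H KH).2 (GH _ G0) H1.
exact: (Kg G KG).2 G0 (HG _ H1).
Qed.

(** The radii already given need no change when one more portion is peeled off:
    a ball around an older point misses the new portion altogether, so a close
    pair has both points old or both in the portion. *)
Lemma partial_gauge_extend (R : realType) (X Y : metricType R)
    (F : set (X -> Y)) (eps : R) (G : set (X * R)) (U : set X) :
  let C := [set x | forall r, ~ G (x, r)] in
  partial_gauge F eps G -> open U ->
  (forall (f : X -> Y) (x y : X), F f -> (C `&` U) x -> (C `&` U) y ->
     mdist (f x) (f y) < eps) ->
  partial_gauge F eps
    (G `|` [set p | [/\ C p.1, 0 < p.2 & forall y, mdist p.1 y < p.2 -> U y]]).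
Proof.
move=> C [Gball Gpair] /open_mdistP oU oscU; split.
  move=> x r [Gxr|[/= Cx r0 rU]].
    have [r0 rG] := Gball x r Gxr; split=> // y /rG[s Gs].
    by exists s; left.
  split=> // y xy; have [Cy|/existsNP[s /contrapT Gys]] := pselect (C y).
    have [s s0 sU] := oU y (rU y xy).
    by exists s; right.
  by exists s; left.
move=> x0 r0 x1 r1 f G0 G1 Ff; rewrite lt_min => /andP[d0 d1].
case: G0 => [G0|[/= C0 p0 U0]]; case: G1 => [G1|[/= C1 p1 U1]].
- by apply: (Gpair x0 r0 x1 r1) => //; rewrite lt_min d0.
- by have [s /C1] := (Gball x0 r0 G0).2 x1 d0.
- by rewrite metric_sym in d1; have [s /C0] := (Gball x1 r1 G1).2 x0 d1.
- by apply: oscU => //; split=> //; [apply: U0|apply: U1]; rewrite mdistxx.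
Qed.

Lemma small_portions_equi_gauge (R : realType) (X Y : metricType R)
    (F : set (X -> Y)) (eps : R) :
  small_portions F eps ->
  exists delta : X -> R, (forall x, 0 < delta x) /\
    forall (x0 x1 : X) (f : X -> Y), F f ->
      mdist x0 x1 < Num.min (delta x0) (delta x1) ->
      mdist (f x0) (f x1) < eps.
Proof.
move=> small.
have [G [gG Gmax]] := Zorn_bigcup (@partial_gauge_chain R X Y F eps).
have Gtot x : exists r, G (x, r).
  apply: contrapT => /forallNP nGx.
  pose C := [set y | forall r, ~ G (y, r)].
  have cC : closed C.
    rewrite -openC; apply/open_mdistP => y /existsNP[r /contrapT Gyr].
    have [r0 rG] := gG.1 y r Gyr; exists r => // z /rG[s Gzs] /(_ s).
    exact.
  have [|U [oU [y [Cy Uy]] oscU]] := small C cC; first by exists x.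
  (* The extension is strict: it contains a pair over a point [y] outside the
     domain of [G]. *)
  apply: Gmax (partial_gauge_extend gG oU oscU); split; first by left.
  move/open_mdistP/(_ y Uy): oU => [r r0 rU].
  by move=> /(_ (y, r)) sub; apply: (Cy r); apply: sub; right.
have [delta deltaG] := choice Gtot.
exists delta; split=> [x|x0 x1 f Ff].
  exact: (gG.1 _ _ (deltaG x)).1.
exact: gG.2 (deltaG x0) (deltaG x1) Ff.
Qed.

(** * Player I *)

(** Contraposition of the previous section: an oscillation of at least [eps] on
    each portion lets some value move by [eps / 2] away from any given point. *)
Lemma not_equi_Baire1_jumps (R : realType) (X Y : metricType R)
    (F : set (X -> Y)) :
  ~ equi_Baire1 F ->
  exists (eps : R) (C : set X), [/\ 0 < eps, C !=set0 &
    forall (U : set X) (x : X), open U -> C x -> U x ->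
      exists y f, [/\ C y, U y, F f & eps <= mdist (f x) (f y)]].
Proof.
move=> /existsNP[eps /not_implyP[eps0]].
move=> /(contra_not (@small_portions_equi_gauge _ _ _ _ _)).
move=> /existsNP[C /not_implyP[_ /not_implyP[C0 nU]]].
exists (eps / 2), C; split=> [||U x oU Cx Ux] //; first by lra.
apply: contrapT => nyf; apply: nU; exists U; split=> //; first by exists x.
have close f y : F f -> (C `&` U) y -> mdist (f x) (f y) < eps / 2.
  move=> Ff [Cy Uy]; rewrite ltNge; apply/negP => far.
  by apply: nyf; exists y, f.
move=> f y z Ff CUy CUz; have := close f y Ff CUy; have := close f z Ff CUz.
have := metric_triangle (f y) (f x) (f z); rewrite (metric_sym (f y) (f x)).
lra.
Qed.

Lemma not_equi_Baire1_I_wins (R : realType) (X Y : metricType R)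
    (F : set (X -> Y)) :
  ~ equi_Baire1 F -> I_has_winning_strategy F.
Proof.
move=> /not_equi_Baire1_jumps[eps [C [eps0 [c Cc] jump]]].
have /choice[step stepP] (p : X * set X) : exists y,
    C p.1 -> open p.2 -> p.2 p.1 -> [/\ C y, p.2 y &
    exists2 f, F f & eps <= mdist (f p.1) (f y)].
  case: p => x U /=.
  have [[Cx [oU Ux]]|nCU] := pselect (C x /\ open U /\ U x).
    by have [y [f [? ? ? ?]]] := jump U x oU Cx Ux; exists y; split=> //; exists f.
  by exists x => Cx oU Ux; case: nCU.
(* Only the last round counts, and [c] is the opening move: [last] returns its
   default value on the empty history. *)
exists (fun h => last c (map step h)) => x U sx; apply/I_winsE.
have x0 : x 0 = c by rewrite sx.
have xS n : x n.+1 = step (x n, U n).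
  by rewrite sx /history mkseqS map_rcons last_rcons.
have stay n : legal_before x U n -> C (x n) /\ legal_I x U n.
  elim: n => [|n IHn] bn; first by rewrite x0.
  have [Cn _] : C (x n) /\ legal_I x U n.
    by apply: IHn => m mn; apply: bn; apply: ltnW.
  have [_ [oU Un]] := bn n (ltnSn n).
  by rewrite /= xS; have [] := stepP (x n, U n) Cn oU Un.
move=> [[n [bn nI]]|[lp [l [_ xl]]]]; first by have [] := stay n bn.
have [|N NP] := xl (eps / 2); first by lra.
have [CN _] : C (x N) /\ legal_I x U N by apply: stay => m _; exact: lp.
have [_ [oU UN]] := lp N.
have [_ _ [f Ff]] := stepP (x N, U N) CN oU UN; rewrite /= -xS.
have := NP N (leqnn _) f Ff; have := NP N.+1 (leqnSn _) f Ff.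
have := metric_triangle (f (x N)) (f l) (f (x N.+1)).
rewrite (metric_sym (f l)); lra.
Qed.

(** * Player II *)

(** The limit of the play is only known to be in the closed balls of these radii;
    halving puts it in the open balls of the gauges. *)
Definition II_radius (R : realType) (X : Type) (delta : nat -> X -> R)
    (n : nat) (x : X) : R :=
  (\big[Num.min/n.+1%:R^-1]_(k < n.+1) delta k x) / 2.

Section IIRadius.
Context (R : realType) (X : Type) (delta : nat -> X -> R).
Context (delta_gt0 : forall k x, 0 < delta k x).

Lemma II_radius_gt0 n x : 0 < II_radius delta n x.
Proof. by apply: divr_gt0 => //; apply: lt_bigmin. Qed.

Lemma II_radius_lt (e : R) n x :
  \big[Num.min/n.+1%:R^-1]_(k < n.+1) delta k x <= e -> II_radius delta n x < e.
Proof.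
have := II_radius_gt0 n x; rewrite /II_radius.
by move: (\big[Num.min/_]_(k < _) _) => m; lra.
Qed.

Lemma II_radius_lt_delta k n x : (k <= n)%N -> II_radius delta n x < delta k x.
Proof.
move=> kn; have kn1 : (k < n.+1)%N by [].
exact/II_radius_lt/(bigmin_le _ (Ordinal kn1)).
Qed.

Lemma II_radius_lt_inv n x : II_radius delta n x < n.+1%:R^-1.
Proof. exact/II_radius_lt/bigmin_le_id. Qed.

End IIRadius.

Lemma equi_Baire1_II_wins (R : realType) (X Y : metricType R)
    (F : set (X -> Y)) :
  complete_space X -> equi_Baire1 F -> II_has_winning_strategy F.
Proof.
move=> cX eB.
have /choice[delta deltaP] (k : nat) :=
  eB k.+1%:R^-1 (eqbRL (invr_gt0 _) (ltr0Sn R k)).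
have delta_gt0 k x : 0 < delta k x by exact: (deltaP k).1.
pose r := II_radius delta.
exists (fun h x => [set y | mdist x y < r (size h) x] `&`
                   last setT [seq p.2 | p <- h]) => x U tU.
have U0 : U 0%N = [set y | mdist (x 0%N) y < r 0%N (x 0%N)].
  by rewrite tU /= setIT.
have US n : U n.+1 = [set y | mdist (x n.+1) y < r n.+1 (x n.+1)] `&` U n.
  by rewrite [LHS]tU /history size_mkseq mkseqS map_rcons last_rcons.
have oU n : open (U n).
  elim: n => [|n IHn]; first by rewrite U0; exact: open_mdist_ball.
  by rewrite US; apply: openI => //; exact: open_mdist_ball.
have legalII n : legal_I x U n -> legal_II x U n.
  have xr : mdist (x n) (x n) < r n (x n) by rewrite mdistxx; exact: II_radius_gt0.
  by case: n xr => [|n] xr Un; split=> //; rewrite ?U0 ?US.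
(* Player II never makes the first illegal move. *)
apply: contrapT => /I_winsE[[n [_ ln]]|[lp]]; first by apply; exact: legalII.
apply.
have Ub n : U n `<=` [set y | mdist (x n) y < r n (x n)].
  by case: n => [|n]; rewrite ?U0 ?US // => y [].
have Unest m n : (m <= n)%N -> U n `<=` U m.
  move=> /subnK <-; elim: (n - m)%N => [|k IHk] y //.
  by rewrite addSn US => -[_ /IHk].
have x_in m n : (m <= n)%N -> mdist (x m) (x n) < r m (x m).
  by move=> mn; apply: Ub; apply: (Unest _ _ mn); have [_ []] := lp n.
have [|l xl lr] := nested_balls_cvg cX _ x_in.
  move=> e e0; have [k] := ltr_add_invr e0; rewrite add0r => ke.
  by exists k; exact: lt_trans (II_radius_lt_inv delta_gt0 _ _) ke.
exists l; split=> // eps eps0.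
have [k] := ltr_add_invr eps0; rewrite add0r => keps.
have /cvgrPdist_lt/(_ _ (delta_gt0 k l))[N _ NP] := xl.
exists (maxn k N) => n; rewrite geq_max => /andP[kn Nn] f Ff.
apply: lt_trans keps; apply: (deltaP k).2 => //.
rewrite lt_min; apply/andP; split.
  exact: le_lt_trans (lr n) (II_radius_lt_delta delta_gt0 _ kn).
by rewrite metric_sym; exact: NP.
Qed.

(** * Determinacy *)

Lemma strategies_meet (X : Type) (s : strategy_I X) (t : strategy_II X) :
  exists (x : nat -> X) (U : nat -> set X), follows_I s x U /\ follows_II t x U.
Proof.
pose h n := iter n (fun h => rcons h (s h, t h (s h))) [::].
exists (fun n => s (h n)), (fun n => t (h n) (s (h n))).
suff hE n : history (fun n => s (h n)) (fun n => t (h n) (s (h n))) n = h n.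
  by split=> n; rewrite hE.
by elim: n => // n IHn; rewrite /history mkseqS -/(history _ _ n) IHn.
Qed.

Lemma not_both_win (R : realType) (X Y : metricType R) (F : set (X -> Y)) :
  I_has_winning_strategy F -> II_has_winning_strategy F -> False.
Proof.
move=> [s sP] [t tP]; have [x [U [sx tx]]] := strategies_meet s t.
by have /I_winsE := sP x U sx; apply; exact: tP.
Qed.

Theorem theorem9 (R : realType) (X Y : metricType R)
    (hX : polish X) (hY : polish Y) (F : set (X -> Y)) :
  [/\ determined F,
      I_has_winning_strategy F <-> ~ equi_Baire1 F
    & II_has_winning_strategy F <-> equi_Baire1 F].
Proof.
have II_of := @equi_Baire1_II_wins R X Y F hX.1.
have I_of := @not_equi_Baire1_I_wins R X Y F.
have excl := @not_both_win R X Y F.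
have [eB|neB] := pselect (equi_Baire1 F).
  split; first by right; exact: II_of.
    by split=> [/excl|//]; case; exact: II_of.
  by split=> // _; exact: II_of.
split; first by left; exact: I_of.
  by split=> // _; exact: I_of.
by split=> [/(excl (I_of neB))|].
Qed.
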